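(* Let $E$ be an edge of $G$ with initial vertex $V_1$ and terminal vertex $V_2$, where $V_1$ is a periodic point of $f$ with period $m$ and rotation element $w_1^{1/m}$ and $V_2$ is a periodic point of $f$ with period $n$ and rotation element $w_2^{1/n}$ (so $\widetilde f^m(\widetilde V_1)=w_1\widetilde V_1$ and $\widetilde f^n(\widetilde V_2)=w_2\widetilde V_2$), and $E$ belongs to the spanning tree used for the coherent labeling. (1) If $E$ belongs to $w_1$ but not to $w_2$, then there exists an initial word $\gamma_1$ of $w_1$ such that for any rational $r$ satisfying $0<r<1/m$ there are integers $p,q$ with $r=p/q$ and a periodic point of $f$ in $E$ with rotation element $(w_1^p\gamma_1)^{1/q}$. (2) If $E$ belongs to $w_2$ but not to $w_1$, then there exists an initial word $\gamma_2$ of $w_2$ such that for any rational $s$ satisfying $0<s<1/n$ there are integers $p',q'$ with $s=p'/q'$ and a periodic point of $f$ in $E$ with rotation element $(w_2^{p'}\gamma_2)^{1/q'}$.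
   Context: $G$ is a finite connected directed graph (multiple edges allowed, no looped edges) with base vertex $x_0$; $\pi=\pi_1(G,x_0)$, a free group; $\widetilde G$ is the universal cover of $G$, a tree. Elements of $\pi$ are identified with covering transformations of $\widetilde G$ (after fixing a lift $\widetilde x_0$ of $x_0$, the lift at $\widetilde x_0$ of a loop in class $\gamma$ ends at $\gamma\widetilde x_0$), and products act by $(\alpha\beta)\widetilde x=\alpha(\beta\widetilde x)$. Coherent labeling: choose a spanning tree $\mathcal T$ of $G$ rooted at $x_0$ and lift it to a tree in $\widetilde G$ through $\widetilde x_0$; this defines the chosen lifts $\widetilde V$ of all vertices and $\widetilde E$ of all edges of $\mathcal T$. For an edge $E\notin\mathcal T$ with initial vertex $V$ and terminal vertex $V'$, $\widetilde E$ is the lift of $E$ starting at $\widetilde V$; it ends at $\theta\widetilde V'$, where $\theta\in\pi$ is the class of the loop formed by $E$ and $\mathcal T$. These $\theta$ are free generators of $\pi$; words, and initial words (possibly empty initial subwords of the reduced word), are with respect to these generators. For $x$ in the interior of an edge $E$, $\widetilde x$ is the point of $\widetilde E$ over $x$; for a vertex, $\widetilde x$ is its chosen lift. The labeling is coherent with $E\in\mathcal T$, so $\widetilde E$ goes from $\widetilde V_1$ to $\widetilde V_2$. $f:G\to G$ is a continuous vertex map (it permutes the vertices of $G$) homotopic to the identity, and $\widetilde f$ is a fixed lift with $\widetilde f(\gamma\widetilde x)=\gamma\widetilde f(\widetilde x)$ for all $\gamma\in\pi$. Rotation element: for $x\in\mathrm{Fix}(f^n)$, let $w\in\pi$ satisfy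 $\widetilde f^n(\widetilde x)=w\widetilde x$; then $\rho(x)=w^{1/n}$. Rational powers are formal, modulo $(w^k)^r=w^{kr}$ for integers $k$ and rationals $r$ (equivalently they lie in the free $\mathbb Q$-group, where $w^{1/n}=v^{1/m}$ iff $w^m=v^n$). Belonging: an edge loop in $G$ is cyclically reduced when its first edge is not the reverse of its last edge (and it has no backtracking). Every loop can be contracted onto a cyclically reduced loop by changing the base point to another vertex of the loop and canceling adjacent inverse edges; the result is called a cyclic reduction. An edge $E$ belongs to $\alpha\in\pi$ when every cyclic reduction of $\alpha$ uses $E$ or $E^{-1}$. *)

(* Defs.v *)
From HB Require Import structures.
From mathcomp Require Import all_boot all_order all_algebra.
From mathcomp Require Import all_classical all_reals all_analysis.

Set Implicit Arguments.
Unset Strict Implicit.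
Unset Printing Implicit Defensive.

Import Order.TTheory GRing.Theory Num.Theory.
Import numFieldNormedType.Exports.

Local Open Scope classical_set_scope.
Local Open Scope ring_scope.

(* Multiple edges are allowed.  Finiteness is a separate hypothesis because the
   universal cover is again a [digraph]. *)
Record digraph := Digraph {
  vertex : choiceType;
  edge : choiceType;
  src : edge -> vertex;
  tgt : edge -> vertex }.

Definition finite_graph (G : digraph) : Prop :=
  finite_set [set: vertex G] /\ finite_set [set: edge G].

Definition loopless (G : digraph) : Prop := forall e : edge G, src e != tgt e.

(* [(e, true)] stands for the edge [e] and [(e, false)] for its reverse. *)
Notation dart G := (edge G * bool)%type.

Section EdgePaths.
Variable G : digraph.
Implicit Types (d : dart G) (p q r : seq (dart G)) (x y : vertex G).

Definition dsrc d : vertex G := if d.2 then src d.1 else tgt d.1.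
Definition dtgt d : vertex G := if d.2 then tgt d.1 else src d.1.
Definition dinv d : dart G := (d.1, ~~ d.2).

Fixpoint epath x p : bool :=
  if p is d :: p' then (dsrc d == x) && epath (dtgt d) p' else true.

Definition pend x p : vertex G := last x (map dtgt p).

Definition pinv p : seq (dart G) := rev (map dinv p).

Definition reduced p : bool := sorted (fun d d' => d' != dinv d) p.

Definition cons_red d p : seq (dart G) :=
  if p is d' :: p' then if d' == dinv d then p' else d :: p else [:: d].

(* Cancels all pairs of adjacent mutually inverse darts. *)
Definition reduce p : seq (dart G) := foldr cons_red [::] p.

Definition connected_graph : Prop :=
  forall x y, exists p, epath x p /\ pend x p = y.

Lemma dinvK : involutive dinv.
Proof. by case=> e b; rewrite /dinv /= negbK. Qed.

Lemma dsrc_dinv d : dsrc (dinv d) = dtgt d.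
Proof. by case: d => e []. Qed.

Lemma dtgt_dinv d : dtgt (dinv d) = dsrc d.
Proof. by case: d => e []. Qed.

Lemma epath_cat x p q : epath x (p ++ q) = epath x p && epath (pend x p) q.
Proof. by elim: p x => //= d p IH x; rewrite IH andbA. Qed.

Lemma pend_cat x p q : pend x (p ++ q) = pend (pend x p) q.
Proof. by rewrite /pend map_cat last_cat. Qed.

Lemma pinv_cons d p : pinv (d :: p) = pinv p ++ [:: dinv d].
Proof. by rewrite /pinv /= rev_cons cats1. Qed.

Lemma pinvK : involutive pinv.
Proof.
by move=> p; rewrite /pinv map_rev revK -map_comp map_id_in // => d _ /=; exact: dinvK.
Qed.

Lemma epath_pinv x p : epath x p ->
  epath (pend x p) (pinv p) /\ pend (pend x p) (pinv p) = x.
Proof.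
elim: p x => [|d p IH] x //= /andP[/eqP <- /IH[pp ee]].
rewrite pinv_cons epath_cat pend_cat -[pend _ (d :: p)]/(pend (dtgt d) p) pp ee.
by rewrite /= dsrc_dinv eqxx /pend /= dtgt_dinv.
Qed.

Lemma cons_red_reduced d p : reduced p -> reduced (cons_red d p).
Proof.
case: p => [|d' p] //= rp; case: ifP => [_|/negbT ne]; first exact: path_sorted rp.
by rewrite /reduced /= ne.
Qed.

Lemma reduce_reduced p : reduced (reduce p).
Proof. by elim: p => //= d p IH; exact: cons_red_reduced. Qed.

Lemma reduce_id p : reduced p -> reduce p = p.
Proof.
elim: p => [|d p IH] //= rp; rewrite (IH (path_sorted rp)).
by case: p rp {IH} => //= d' p; rewrite /reduced /= => /andP[/negbTE-> _].
Qed.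

Lemma cons_redK d p : reduced p -> cons_red d (cons_red (dinv d) p) = p.
Proof.
case: p => [|d' p] /=; first by rewrite eqxx.
rewrite dinvK; case: eqP => [->|ne] rp; last by rewrite /= eqxx.
by case: p rp => //= d'' p; rewrite /reduced /= => /andP[/negbTE-> _].
Qed.

Lemma foldr_reduced p s : reduced s -> reduced (foldr cons_red s p).
Proof. by move=> rs; elim: p => //= d p IH; exact: cons_red_reduced. Qed.

Lemma foldr_reduce p s : reduced s ->
  foldr cons_red s (reduce p) = foldr cons_red s p.
Proof.
move=> rs; elim: p => //= d p <-; case: (reduce p) => //= d' q.
by case: eqP => // ->; rewrite /= cons_redK // foldr_reduced.
Qed.

Lemma reduce_catr p q : reduce (p ++ reduce q) = reduce (p ++ q).
Proof. by rewrite /reduce !foldr_cat -/(reduce q) -/(reduce (reduce q)) reduce_id ?reduce_reduced. Qed.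

Lemma reduce_catl p q : reduce (reduce p ++ q) = reduce (p ++ q).
Proof. by rewrite {1 3}/reduce !foldr_cat foldr_reduce // reduce_reduced. Qed.

Lemma reduce_pinvr p : reduce (p ++ pinv p) = [::].
Proof.
elim: p => //= d p IH.
by rewrite pinv_cons catA -reduce_catl IH /= eqxx.
Qed.

Lemma reduce_pinvl p : reduce (pinv p ++ p) = [::].
Proof. by rewrite -{2}[p]pinvK reduce_pinvr. Qed.

Lemma epath_reduce x p : epath x p ->
  epath x (reduce p) /\ pend x (reduce p) = pend x p.
Proof.
elim: p x => [|d p IH] x //= /andP[/eqP dx /IH[]].
rewrite -[pend x (d :: p)]/(pend (dtgt d) p).
case: (reduce p) => [|d' q] /=; first by rewrite dx eqxx.
case/andP=> /eqP d'x pq <-.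
case: eqP => [d'E|_]; last by rewrite /= dx d'x !eqxx pq.
by move: pq; rewrite d'E dtgt_dinv dx /pend /= dtgt_dinv dx.
Qed.

Lemma all_reduce (a : pred (dart G)) p : all a p -> all a (reduce p).
Proof.
elim: p => //= d p IH /andP[ad /IH]; case: (reduce p) => [|d' q] /=.
  by rewrite ad.
by case: eqP => _ /andP[ad' aq] /=; rewrite ?ad ?ad'.
Qed.

End EdgePaths.

(* [pi1 x0] is the edge-path group: each homotopy class of loops at [x0] is
   represented by its unique reduced edge loop. *)
Section FundamentalGroup.
Variables (G : digraph) (x0 : vertex G).

Record pi1 := Pi1 {
  loop_of :> seq (dart G);
  _ : [&& epath x0 loop_of, pend x0 loop_of == x0 & reduced loop_of] }.

HB.instance Definition _ := [isSub for loop_of].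
HB.instance Definition _ := [Choice of pi1 by <:].

Lemma pi1P (g : pi1) : [/\ epath x0 g, pend x0 g = x0 & reduced g].
Proof. by case: g => p /= /and3P[? /eqP ? ?]. Qed.

Lemma pi1_reduce_subproof p : epath x0 p -> pend x0 p = x0 ->
  [&& epath x0 (reduce p), pend x0 (reduce p) == x0 & reduced (reduce p)].
Proof.
by move=> pp ep; have [-> ->] := epath_reduce pp; rewrite ep eqxx reduce_reduced.
Qed.

Definition pi1_class p (pp : epath x0 p) (ep : pend x0 p = x0) : pi1 :=
  Pi1 (pi1_reduce_subproof pp ep).

Lemma pi1_one_subproof :
  [&& epath x0 [::], pend x0 [::] == x0 & @reduced G [::]].
Proof. by rewrite eqxx. Qed.

Lemma pi1_mul_subproof (g h : pi1) :
  epath x0 (g ++ h) /\ pend x0 (g ++ h) = x0.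
Proof.
have [pg eg _] := pi1P g; have [ph eh _] := pi1P h.
by rewrite epath_cat pend_cat eg pg ph eh.
Qed.

Lemma pi1_inv_subproof (g : pi1) :
  epath x0 (pinv g) /\ pend x0 (pinv g) = x0.
Proof.
by have [pg eg _] := pi1P g; have := epath_pinv pg; rewrite eg.
Qed.

Definition pi1_one : pi1 := Pi1 pi1_one_subproof.
Definition pi1_mul (g h : pi1) : pi1 :=
  pi1_class (pi1_mul_subproof g h).1 (pi1_mul_subproof g h).2.
Definition pi1_inv (g : pi1) : pi1 :=
  pi1_class (pi1_inv_subproof g).1 (pi1_inv_subproof g).2.

Lemma pi1_mulA : associative pi1_mul.
Proof.
by move=> a b c; apply: val_inj; rewrite /= reduce_catr reduce_catl catA.
Qed.

Lemma pi1_mul1g : left_id pi1_one pi1_mul.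
Proof. by move=> a; apply: val_inj; have [_ _ /reduce_id] := pi1P a. Qed.

Lemma pi1_mulg1 : right_id pi1_one pi1_mul.
Proof.
by move=> a; apply: val_inj; rewrite /= cats0; have [_ _ /reduce_id] := pi1P a.
Qed.

Lemma pi1_mulVg : left_inverse pi1_one pi1_inv pi1_mul.
Proof. by move=> a; apply: val_inj; rewrite /= reduce_catl reduce_pinvl. Qed.

Lemma pi1_mulgV : right_inverse pi1_one pi1_inv pi1_mul.
Proof. by move=> a; apply: val_inj; rewrite /= reduce_catr reduce_pinvr. Qed.

HB.instance Definition _ := isGroup.Build pi1
  pi1_mulA pi1_mul1g pi1_mulg1 pi1_mulVg pi1_mulgV.

End FundamentalGroup.

(* The universal cover, in its standard model: its vertices are the reduced edge
   paths of [G] starting at [x0] (the empty path being the base vertex), and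
   [(u, e)] is the lift of the edge [e] that starts at the vertex [u]. *)
Section UniversalCover.
Variables (G : digraph) (x0 : vertex G).

Record rpath := RPath {
  path_of :> seq (dart G);
  _ : epath x0 path_of && reduced path_of }.

HB.instance Definition _ := [isSub for path_of].
HB.instance Definition _ := [Choice of rpath by <:].

Lemma rpathP (u : rpath) : epath x0 u /\ reduced u.
Proof. by case: u => p /= /andP[]. Qed.

Lemma rpath_reduce_subproof p : epath x0 p ->
  epath x0 (reduce p) && reduced (reduce p).
Proof. by move=> /epath_reduce[-> _]; rewrite reduce_reduced. Qed.

Definition rpath_class p (pp : epath x0 p) : rpath :=
  RPath (rpath_reduce_subproof pp).

(* The vertex of [G] below the vertex [u]. *)
Definition rend (u : rpath) : vertex G := pend x0 u.

Record ledge := LEdge {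
  ledge_of :> rpath * edge G;
  _ : rend ledge_of.1 == src ledge_of.2 }.

HB.instance Definition _ := [isSub for ledge_of].
HB.instance Definition _ := [Choice of ledge by <:].

Lemma ledgeP (a : ledge) : rend a.1 = src a.2.
Proof. by case: a => a /= /eqP. Qed.

Lemma ledge_tgt_subproof (a : ledge) : epath x0 (rcons a.1 (a.2, true)).
Proof.
have [pa _] := rpathP a.1.
by rewrite -cats1 epath_cat pa /= [pend _ _]ledgeP eqxx.
Qed.

Definition ledge_src (a : ledge) : rpath := a.1.
Definition ledge_tgt (a : ledge) : rpath := rpath_class (ledge_tgt_subproof a).

Definition ucover : digraph := Digraph ledge_src ledge_tgt.

Lemma deckV_subproof (g : pi1 x0) (u : rpath) : epath x0 (g ++ u).
Proof.
have [pg eg _] := pi1P g; have [pu _] := rpathP u.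
by rewrite epath_cat eg pg pu.
Qed.

Definition deckV (g : pi1 x0) (u : vertex ucover) : vertex ucover :=
  rpath_class (deckV_subproof g u).

Lemma rend_deckV g u : rend (deckV g u) = rend u.
Proof.
have [_ eg _] := pi1P g.
by rewrite /rend /= (epath_reduce (deckV_subproof g u)).2 pend_cat eg.
Qed.

Lemma deckE_subproof (g : pi1 x0) (a : ledge) : rend (deckV g a.1) == src a.2.
Proof. by rewrite rend_deckV ledgeP. Qed.

Definition deckE (g : pi1 x0) (a : edge ucover) : edge ucover :=
  @LEdge (deckV g a.1, a.2) (deckE_subproof g a).

End UniversalCover.

Section Realization.
Variables (R : realType) (G : digraph).

Inductive realization :=
  | RVertex of vertex G
  | REdge of edge G & {t : R | 0 < t < 1}.

HB.instance Definition _ := gen_eqMixin realization.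
HB.instance Definition _ := gen_choiceMixin realization.

(* The characteristic map of the 1-cell [e], precomposed with the retraction of
   the real line onto [0, 1]. *)
Definition edge_map (e : edge G) (t : R) : realization :=
  if insub t is Some s then REdge e s
  else if t <= 0 then RVertex (src e) else RVertex (tgt e).

Definition closed_edge (e : edge G) : set realization :=
  edge_map e @` `[0, 1].

(* The CW (quotient) topology of the disjoint union of the discrete set of
   vertices and of one copy of [0, 1] for each edge. *)
Definition realization_open (U : set realization) : Prop :=
  forall e : edge G, open (edge_map e @^-1` U).

Lemma realization_openT : realization_open setT.
Proof. by move=> e; rewrite preimage_setT; exact: openT. Qed.

Lemma realization_openI : setI_closed realization_open.
Proof. by move=> U V oU oV e; rewrite preimage_setI; exact: openI. Qed.

Lemma realization_open_bigU (I : Type) (U : I -> set realization) :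
  (forall i, realization_open (U i)) -> realization_open (\bigcup_i U i).
Proof.
by move=> oU e; rewrite preimage_bigcup; apply: bigcup_open => i _; exact: oU.
Qed.

HB.instance Definition _ := isOpenTopological.Build realization
  realization_openT realization_openI realization_open_bigU.

End Realization.

Arguments RVertex {R G} v.
Arguments REdge {R G} e t.
Arguments closed_edge {R G} e.

(* The map induced on realizations by a morphism of graphs. *)
Definition realization_map (R : realType) (G H : digraph)
    (phiV : vertex G -> vertex H) (phiE : edge G -> edge H)
    (x : realization R G) : realization R H :=
  match x with
  | RVertex v => RVertex (phiV v)
  | REdge e t => REdge (phiE e) t
  end.

Definition homotopic (R : realType) (X Y : topologicalType) (f g : X -> Y) :=
  exists H : X * R -> Y,
    [/\ {within [set: X] `*` `[0, 1], continuous H},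
        forall x, H (x, 0) = f x & forall x, H (x, 1) = g x].

Definition vertex_map (R : realType) (G : digraph)
    (f : realization R G -> realization R G) : Prop :=
  exists2 s : vertex G -> vertex G,
    bijective s & forall v, f (RVertex v) = RVertex (s v).

Section Covering.
Variables (R : realType) (G : digraph) (x0 : vertex G).

Definition covering_map : realization R (ucover x0) -> realization R G :=
  realization_map (@rend G x0 : vertex (ucover x0) -> _)
                  (fun a : edge (ucover x0) => (ledge_of a).2).

Definition deck (g : pi1 x0) :
    realization R (ucover x0) -> realization R (ucover x0) :=
  realization_map (deckV g) (deckE g).

Definition is_lift (f : realization R G -> realization R G)
    (ft : realization R (ucover x0) -> realization R (ucover x0)) : Prop :=
  continuous ft /\ forall y, covering_map (ft y) = f (covering_map y).

End Covering.

Section CoherentLabeling.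
Variables (G : digraph) (x0 : vertex G).

Definition path_in (T : pred (edge G)) (p : seq (dart G)) : bool :=
  all (fun d => T d.1) p.

Record spanning_tree := SpanningTree {
  in_tree : pred (edge G);
  tree_connected : forall u v, exists p,
    [/\ epath u p, pend u p = v & path_in in_tree p];
  tree_acyclic : forall u p, epath u p -> pend u p = u -> reduced p ->
    path_in in_tree p -> p = [::] }.

Variable T : spanning_tree.

Lemma lift_subproof (v : vertex G) :
  exists u : rpath x0, (rend u == v) && path_in (in_tree T) u.
Proof.
have [p [pp ep Tp]] := tree_connected T x0 v.
exists (rpath_class pp); rewrite /rend /= (epath_reduce pp).2 ep eqxx.
exact: all_reduce.
Qed.

(* The vertex above [v] of the lift of the tree [T] through the base vertex,
   that is, the unique reduced path in [T] from [x0] to [v]. *)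
Definition lift_vertex (v : vertex G) : vertex (ucover x0) :=
  xchoose (lift_subproof v).

Lemma rend_lift v : rend (lift_vertex v) = v.
Proof. by have /andP[/eqP] := xchooseP (lift_subproof v). Qed.

Lemma lift_vertex_unique (u : rpath x0) :
  path_in (in_tree T) u -> lift_vertex (rend u) = u.
Proof.
move=> Tu; set w := lift_vertex _.
have [pu ru] := rpathP u; have [pw rw] := rpathP w.
have ew : pend x0 w = pend x0 u := rend_lift (rend u).
have /andP[_ Tw] := xchooseP (lift_subproof (rend u)).
have [pi ei] := epath_pinv pu.
have pp : epath x0 (path_of w ++ pinv u) by rewrite epath_cat pw ew.
have [prp erp] := epath_reduce pp.
have /(tree_acyclic (s := T) prp) nil : pend x0 (reduce (path_of w ++ pinv u)) = x0.
  by rewrite erp pend_cat ew.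
apply: val_inj; rewrite /= -[LHS](reduce_id rw) -[RHS](reduce_id ru).
rewrite -[X in reduce X = _]cats0 -(reduce_pinvl u) reduce_catr catA.
rewrite -reduce_catl nil ?reduce_reduced //.
apply: all_reduce; rewrite all_cat; apply/andP; split; first exact: Tw.
by rewrite all_rev all_map.
Qed.

Lemma lift_edge_subproof (e : edge G) : rend (lift_vertex (src e)) == src e.
Proof. by rewrite rend_lift. Qed.

(* For [e] in [T] this is the edge above [e] of the lift of [T]. *)
Definition lift_edge (e : edge G) : edge (ucover x0) :=
  @LEdge G x0 (lift_vertex (src e), e) (lift_edge_subproof e).

Definition lift_point (R : realType) :
    realization R G -> realization R (ucover x0) :=
  realization_map lift_vertex lift_edge.

Definition theta_path (e : edge G) : seq (dart G) :=
  path_of (lift_vertex (src e)) ++ (e, true) :: pinv (path_of (lift_vertex (tgt e))).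

Lemma theta_subproof e :
  epath x0 (theta_path e) /\ pend x0 (theta_path e) = x0.
Proof.
have [ps _] := rpathP (lift_vertex (src e)).
have [pt _] := rpathP (lift_vertex (tgt e)).
have es : pend x0 (lift_vertex (src e)) = src e := rend_lift (src e).
have et : pend x0 (lift_vertex (tgt e)) = tgt e := rend_lift (tgt e).
have := epath_pinv pt; rewrite et /theta_path epath_cat pend_cat ps es /=.
by rewrite eqxx => -[].
Qed.

Definition theta (e : edge G) : pi1 x0 :=
  pi1_class (theta_subproof e).1 (theta_subproof e).2.

(* Words in the generators: the letter [(e, true)], with [e] not in [T], stands
   for [theta e], and [(e, false)] stands for its inverse. *)
Definition reduced_word (s : seq (dart G)) : bool :=
  reduced s && all (fun d => ~~ in_tree T d.1) s.

Definition word_eval (s : seq (dart G)) : pi1 x0 :=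
  (\prod_(d <- s) (if d.2 then theta d.1 else (theta d.1)^-1))%g.

Definition initial_word (w g : pi1 x0) : Prop :=
  exists s1 s2 : seq (dart G),
    [/\ reduced_word (s1 ++ s2), word_eval (s1 ++ s2) = w & word_eval s1 = g].

End CoherentLabeling.

Section RotationElements.
Variables (G : digraph) (x0 : vertex G).

(* [w ^ (1/n) = v ^ (1/m)] in the free Q-group. *)
Definition root_eq (w : pi1 x0) (n : nat) (v : pi1 x0) (m : nat) : Prop :=
  (w ^+ m = v ^+ n)%g.

Variables (T : spanning_tree G) (R : realType).
Variables (f : realization R G -> realization R G)
          (ft : realization R (ucover x0) -> realization R (ucover x0)).

Definition fixed_with (n : nat) (w : pi1 x0) (x : realization R G) : Prop :=
  iter n f x = x /\
  iter n ft (lift_point x0 T x) = deck w (lift_point x0 T x).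

(* [x] is a periodic point whose rotation element is [v ^ (1/m)]. *)
Definition has_rotation_element (x : realization R G) (v : pi1 x0) (m : nat) :
    Prop :=
  exists n w, [/\ (0 < n)%N, fixed_with n w x & root_eq w n v m].

End RotationElements.

Section Belonging.
Variable G : digraph.

(* One contraction step on edge loops: moving the base point along the loop, or
   cancelling two adjacent mutually inverse darts. *)
Inductive contracts : seq (dart G) -> seq (dart G) -> Prop :=
  | contracts_refl p : contracts p p
  | contracts_rot p q k : contracts (rot k p) q -> contracts p q
  | contracts_cancel p1 p2 d q :
      contracts (p1 ++ p2) q -> contracts (p1 ++ [:: d, dinv d & p2]) q.

Definition cyclically_reduced (p : seq (dart G)) : bool :=
  reduced p && (if p is d :: p' then d != dinv (last d p') else true).

Definition cyclic_reduction (p q : seq (dart G)) : Prop :=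
  contracts p q /\ cyclically_reduced q.

Definition belongs (x0 : vertex G) (E : edge G) (a : pi1 x0) : Prop :=
  forall q, cyclic_reduction a q -> E \in map fst q.

End Belonging.

(* Main.v *)
From HB Require Import structures.
From mathcomp Require Import all_boot all_order all_algebra.
From mathcomp Require Import all_classical all_reals all_analysis.
From mathcomp Require Import ring lra zify.
(* After the analysis library, whose [pinv] would hide the inverse path. *)
Require Import Defs.

Set Implicit Arguments.
Unset Strict Implicit.
Unset Printing Implicit Defensive.

Import Order.TTheory GRing.Theory Num.Theory.
Import numFieldNormedType.Exports.

Local Open Scope classical_set_scope.
Local Open Scope ring_scope.

(* Let V1, V2 be the chosen lifts of the ends of E, and suppose that E belongs
   to w1 but not to w2.  The axis of w1 in the universal cover crosses a lift
   g E of E, hence all the w1^k g E, and g can be taken to be an initial word of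
   w1, because a fundamental domain of the axis lies on the geodesic from the
   base vertex to its translate by w1.  No lift of E separates the points
   w2^j v for a suitable vertex v (on the axis of w2).  Any two given vertices
   are separated by finitely many lifts of E only, so when k and i - k are large
   the edge w1^k g E separates w1^i V1 from w2^j V2 for every j; uniformity in
   j holds because no nontrivial power of w1 is a power of w2.  Now if
   q = i m = j n, these points are the images under the q-th iterate of the lift
   of f of the ends of the lift of E, so by the intermediate value theorem this
   iterate and w1^k g agree at some point of the lift of E.  For r = a/b take k
   and q to be the same large multiple of a and b; then r < 1/m makes
   i - k = q/m - k large. *)

(** * Free reduction, cyclic reduction and conjugacy of edge loops *)

Section FreeReduction.
Variable G : digraph.
Implicit Types (d z : dart G) (c p q s : seq (dart G)).

Lemma reduce_eq p q q' s :
  reduce q = reduce q' -> reduce (p ++ q ++ s) = reduce (p ++ q' ++ s).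
Proof.
by move=> e; rewrite -(reduce_catr p) -(reduce_catl q) e reduce_catl reduce_catr.
Qed.

Lemma reduce_eqr p q q' : reduce q = reduce q' -> reduce (p ++ q) = reduce (p ++ q').
Proof. by move=> e; rewrite -reduce_catr e reduce_catr. Qed.

Lemma reduce_eql q q' s : reduce q = reduce q' -> reduce (q ++ s) = reduce (q' ++ s).
Proof. by move=> e; rewrite -reduce_catl e reduce_catl. Qed.

Lemma reduceK p q s : reduce (p ++ pinv q ++ q ++ s) = reduce (p ++ s).
Proof. by rewrite [pinv q ++ _]catA (@reduce_eq p _ [::]) // reduce_pinvl. Qed.

Lemma reduceVK p q s : reduce (p ++ q ++ pinv q ++ s) = reduce (p ++ s).
Proof. by rewrite [q ++ _]catA (@reduce_eq p _ [::]) // reduce_pinvr. Qed.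

Lemma pinv_cat p q : pinv (p ++ q) = pinv q ++ pinv p.
Proof. by rewrite /pinv map_cat rev_cat. Qed.

Lemma pinv_rcons p d : pinv (rcons p d) = dinv d :: pinv p.
Proof. by rewrite -cats1 pinv_cat. Qed.

Lemma reduce_pinv_eq p q :
  reduce p = reduce q -> reduce (pinv p) = reduce (pinv q).
Proof.
move=> e; rewrite -(cats0 (pinv p)) -(reduceVK _ q) cats0.
by rewrite -(reduce_eq _ _ e) -[LHS]/(reduce ([::] ++ _)) reduceK.
Qed.

Lemma reduced_cat p q :
  reduced (p ++ q) = [&& reduced p, reduced q &
    (if p is d :: p' then if q is d' :: _ then d' != dinv (last d p') else true
     else true)].
Proof.
case: p => [|d p]; first by rewrite /= andbT.
rewrite /reduced /= cat_path; case: q => [|d' q] /=; first by rewrite !andbT.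
by rewrite [_ && (_ != _)]andbC.
Qed.

Lemma reduced_rcons p d d' :
  reduced (rcons (rcons p d) d') = reduced (rcons p d) && (d' != dinv d).
Proof.
case: p => [|z p]; first by rewrite /reduced /= andbT.
by rewrite /reduced /= [in LHS]rcons_path last_rcons.
Qed.

Lemma reduced_pinv p : reduced (pinv p) = reduced p.
Proof.
rewrite /reduced /pinv rev_sorted sorted_map; apply: eq_sorted => d d' /=.
by rewrite dinvK eq_sym.
Qed.

Definition starts_with z p := ohead p == Some z.

(** A letter appended to a reduced word alters only its right end, so this change occurs only on
    passing between the empty word and [[:: z]]. *)
Lemma starts_with_step z p q d :
  starts_with z (reduce (p ++ rcons q d)) != starts_with z (reduce (p ++ q)) ->
  reduce (p ++ q) = [::] /\ d = z \/ reduce (p ++ q) = [:: z] /\ d = dinv z.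
Proof.
rewrite -rcons_cat -cats1 -reduce_catl.
have := reduce_reduced (p ++ q); case/lastP: (reduce (p ++ q)) => [|y l] ry.
  by rewrite /starts_with /= (inj_eq Some_inj); case: (d =P z) => // -> _; left.
rewrite cats1; have [->|nd] := eqVneq d (dinv l).
  have ry' : reduced y by move: ry; rewrite -cats1 reduced_cat => /andP[].
  have -> : reduce (rcons (rcons y l) (dinv l)) = y.
    by rewrite -!cats1 -catA -[[:: l] ++ _]/([:: l] ++ pinv [:: l])
      -reduce_catr reduce_pinvr cats0 reduce_id.
  case: y ry {ry'} => [|y' y] _; last by rewrite /starts_with /= eqxx.
  rewrite /starts_with /= (inj_eq Some_inj).
  by case: (l =P z) => // -> _; right.
rewrite reduce_id ?reduced_rcons ?ry //.
by case: y {ry} => [|y' y]; rewrite /starts_with /= eqxx.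
Qed.

Lemma reduced_flatten c k : cyclically_reduced c -> reduced (flatten (nseq k c)).
Proof.
case: c => [|d c]; first by move=> _; elim: k.
rewrite /cyclically_reduced => /andP[rc nd]; elim: k => [|k IH] //.
rewrite -[flatten _]/((d :: c) ++ flatten _) reduced_cat rc IH.
by case: (k).
Qed.

(** Mutually inverse end letters are peeled off, by induction on the length, until none are left. *)
Lemma cyclic_decomposition w : reduced w ->
  exists u c, w = u ++ c ++ pinv u /\ cyclically_reduced c.
Proof.
have [N] := ubnP (size w); elim: N w => // N IH w sw rw.
have [cw|ncw] := boolP (cyclically_reduced w).
  by exists [::], w; rewrite cats0.
case: w => [|d w] in rw sw ncw *; first by [].
move: ncw; rewrite /cyclically_reduced rw /= negbK.
case/lastP: w => [|w l] in rw sw *.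
  by move=> /eqP/(congr1 snd)/=; case: (d.2).
rewrite last_rcons => /eqP dE.
move: rw; rewrite -cats1 -[_ :: _]/([:: d] ++ w ++ [:: l]) reduced_cat => /and3P[_ rw _].
move: rw; rewrite reduced_cat => /andP[rw _].
have [|u [c [wE cc]]] := IH w _ rw.
  by move: sw; rewrite /= size_rcons; lia.
exists (d :: u), c; split=> //.
by rewrite wE pinv_cons dE dinvK -!catA.
Qed.

Lemma contracts_conj u c : contracts (u ++ c ++ pinv u) c.
Proof.
elim: u => [|d u IH]; first by rewrite cats0; exact: contracts_refl.
apply: (contracts_rot (k := 1)).
have -> : rot 1 ((d :: u) ++ c ++ pinv (d :: u)) =
    (u ++ c ++ pinv u) ++ [:: dinv d, dinv (dinv d) & [::]].
  by rewrite dinvK rot1_cons pinv_cons -cats1 -!catA.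
by apply: contracts_cancel; rewrite cats0.
Qed.

(** Cancellation does not change the free class, and a rotation conjugates it by the part moved,
    which is appended to [v]. *)
Lemma contracts_conjugate w v p q : contracts p q ->
  reduce (w ++ v) = reduce (v ++ p) ->
  exists v', reduce (w ++ v') = reduce (v' ++ q).
Proof.
move=> pq; elim: pq v => {p q} [p|p q k _ IH|p1 p2 d q _ IH] v wv.
- by exists v.
- apply: (IH (v ++ take k p)).
  by rewrite /rot catA (reduce_eql _ wv) -!catA [take k p ++ _]catA cat_take_drop.
- apply: (IH v); rewrite wv.
  by have := reduceVK (v ++ p1) [:: d] p2; rewrite -!catA.
Qed.

End FreeReduction.

(** * Initial words read off edge loops *)

Section InitialWords.
Variables (G : digraph) (x0 : vertex G) (T : spanning_tree G).
Implicit Types (d : dart G) (p s : seq (dart G)) (e : edge G) (g w : pi1 x0).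

Lemma loop_mul g h : loop_of (g * h)%g = reduce (loop_of g ++ loop_of h).
Proof. by []. Qed.

Lemma loop_mul_cat g h p : reduce (loop_of (g * h)%g ++ p) = reduce (g ++ h ++ p).
Proof. by rewrite loop_mul reduce_catl catA. Qed.

Lemma reduce_loop g : reduce g = g.
Proof. by have [_ _ /reduce_id] := pi1P g. Qed.

Lemma lift_vertex_base : path_of (lift_vertex x0 T x0) = [::].
Proof.
have nilP : epath x0 [::] && @reduced G [::] by [].
by have := lift_vertex_unique (T := T) (u := RPath nilP) isT; rewrite {1}/rend /= => ->.
Qed.

Let tree d := in_tree T d.1.

Lemma lift_vertex_tree d : tree d ->
  path_of (lift_vertex x0 T (dtgt d)) =
  reduce (rcons (lift_vertex x0 T (dsrc d)) d).
Proof.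
move=> Td; set u := lift_vertex x0 T (dsrc d).
have [pu _] := rpathP u; have eu : pend x0 u = dsrc d := rend_lift x0 T (dsrc d).
have pud : epath x0 (rcons u d) by rewrite -cats1 epath_cat pu eu /= eqxx.
have eud : rend (rpath_class pud) = dtgt d.
  by rewrite /rend /= (epath_reduce pud).2 -cats1 pend_cat.
rewrite -eud lift_vertex_unique //; apply: all_reduce.
have /andP[_ Tu] := xchooseP (lift_subproof x0 T (dsrc d)).
by rewrite all_rcons; apply/andP; split; [exact: Td|exact: Tu].
Qed.

Definition letter d : pi1 x0 := if d.2 then theta x0 T d.1 else (theta x0 T d.1)^-1%g.

Lemma theta_lift e :
  reduce (theta x0 T e ++ lift_vertex x0 T (tgt e)) =
  reduce (rcons (lift_vertex x0 T (src e)) (e, true)).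
Proof.
rewrite /theta /= reduce_catl /theta_path -catA cat_cons -cat_rcons.
by rewrite -[pinv _ ++ _]cats0 -catA reduceK cats0.
Qed.

Lemma letter_lift d :
  reduce (letter d ++ lift_vertex x0 T (dtgt d)) =
  reduce (rcons (lift_vertex x0 T (dsrc d)) d).
Proof.
case: d => e [] /=; first exact: theta_lift.
rewrite /letter /= reduce_catl.
have := reduce_eql [:: (e, false)] (theta_lift e).
rewrite -!cats1 -!catA -[[:: _] ++ _]/([:: (e, true)] ++ pinv [:: (e, true)]).
rewrite -[[:: _] ++ pinv _]cats0 -catA reduceVK cats0.
move/(reduce_eqr (pinv (theta x0 T e))) => <-.
by rewrite -[LHS]/(reduce ([::] ++ _)) reduceK.
Qed.

Lemma word_eval_rcons s d :
  word_eval x0 T (rcons s d) = (word_eval x0 T s * letter d)%g.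
Proof. by rewrite /word_eval -cats1 big_cat big_seq1. Qed.

(** A tree dart leads from one chosen lift to another and contributes nothing; any other dart
    changes the translate by its [letter]. *)
Lemma word_eval_lift p : epath x0 p ->
  reduce (word_eval x0 T [seq d <- p | ~~ tree d] ++ lift_vertex x0 T (pend x0 p))
  = reduce p.
Proof.
elim/last_ind: p => [_|p d IH].
  by rewrite /word_eval big_nil /= lift_vertex_base.
rewrite -cats1 epath_cat /= andbT => /andP[pp /eqP dp].
rewrite pend_cat {1}cats1 filter_rcons [pend _ [:: d]]/=.
have {IH}<- := reduce_eql [:: d] (IH pp); rewrite -dp -catA cats1.
case: ifP => [_|/negbFE Td].
  rewrite word_eval_rcons loop_mul_cat; apply: reduce_eqr; exact: letter_lift.
by rewrite lift_vertex_tree // reduce_catr.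
Qed.

(** If two consecutive non-tree darts cancelled, the tree segment between them would be a reduced
    closed path in [T], hence empty, and the path itself would backtrack. *)
Lemma reduced_nontree x p : epath x p -> reduced p ->
  reduced [seq d <- p | ~~ tree d].
Proof.
(* Here [d] is the last non-tree dart met and [t] the tree segment read since then. *)
have main q : forall d t, ~~ tree d -> all tree t -> epath (dtgt d) (t ++ q) ->
    reduced (d :: t ++ q) ->
    path (fun d d' => d' != dinv d) d [seq d <- q | ~~ tree d].
  elim: q => [|d' q IH] // d t nTd Tt pt rt /=.
  case: ifP => [nTd'|/negbFE Td']; last first.
    by apply: (IH _ (rcons t d')); rewrite ?all_rcons ?Td' ?cat_rcons.
  move: pt rt; rewrite epath_cat -cat_cons reduced_cat.
  move=> /and3P[pt /eqP d'E pq] /and3P[rt rq dd'] /=.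
  apply/andP; split; last exact: (IH d' [::]).
  apply: contraTneq dd' => d'd; rewrite negbK.
  have nil : t = [::].
    apply: (tree_acyclic (s := T) pt) => //; last by case: (t) rt => //= ? ? /andP[].
    by rewrite -d'E d'd dsrc_dinv.
  by rewrite nil /= d'd.
elim: p x => [|d p IH] x //= /andP[_ pp] rp.
case: ifP => [nTd|_]; last by apply: (IH _ pp); exact: path_sorted rp.
exact: (main _ _ [::]).
Qed.


(** Dropping tree darts commutes with concatenation, so cutting the loop of [w] also cuts its
    reduced word. *)
Lemma initial_word_lift w p q : loop_of w = p ++ q ->
  exists2 g : pi1 x0, initial_word T w g &
    reduce (g ++ lift_vertex x0 T (pend x0 p)) = reduce p.
Proof.
move=> wE; have [pw ew rw] := pi1P w.
have pp : epath x0 p by move: pw; rewrite wE epath_cat => /andP[].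
exists (word_eval x0 T [seq d <- p | ~~ tree d]); last exact: word_eval_lift.
exists [seq d <- p | ~~ tree d], [seq d <- q | ~~ tree d].
rewrite -filter_cat -wE; split=> //.
  by rewrite /reduced_word (reduced_nontree pw) // filter_all.
apply: val_inj; have := word_eval_lift pw.
by rewrite ew lift_vertex_base cats0 !reduce_loop.
Qed.

End InitialWords.

(** * Sides of the lifts of [E] in the tree, and axes of deck transformations *)

Section Sides.
Variables (G : digraph) (x0 : vertex G) (T : spanning_tree G) (E : edge G).
Implicit Types (c p u v : seq (dart G)) (g h w : pi1 x0).

Let V1 : seq (dart G) := lift_vertex x0 T (src E).

(* Removing the interior of the lift [deckE g (lift_edge x0 T E)] cuts the tree
   [ucover x0] into two pieces: [side g v] tells whether the (not necessarily
   reduced) path [v] ends in the piece of its terminal vertex. *)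
Definition side g v := starts_with (E, true) (reduce (pinv V1 ++ pinv g ++ v)).

Lemma eq_side g v v' : reduce v = reduce v' -> side g v = side g v'.
Proof. by move=> e; rewrite /side catA (reduce_eqr _ e) -catA. Qed.

Lemma side_mul h g v : side (h * g)%g (h ++ v) = side g v.
Proof.
rewrite /side; congr starts_with; rewrite loop_mul.
have e : reduce (pinv (reduce (h ++ g))) = reduce (pinv g ++ pinv h).
  by rewrite -pinv_cat; apply: reduce_pinv_eq; rewrite reduce_id ?reduce_reduced.
by rewrite (reduce_eq _ _ e) -!catA catA reduceK -catA.
Qed.

Lemma sideE g p v : reduce (g ++ V1) = reduce p ->
  side g v = starts_with (E, true) (reduce (pinv p ++ v)).
Proof.
by move=> /reduce_pinv_eq/(reduce_eql v); rewrite pinv_cat -catA /side => ->.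
Qed.

Lemma loop_inj_lift g h p : reduce (g ++ p) = reduce (h ++ p) -> g = h.
Proof.
move=> /(reduce_eql (pinv p)); rewrite -!catA -[p ++ pinv p]cats0 -catA !reduceVK.
by rewrite !cats0 !reduce_loop => /val_inj.
Qed.

(** This is [starts_with_step] seen from the initial vertex of the lift: the side changes only when
    the step traverses the lift itself, in one direction or the other. *)
Lemma side_step g v d : side g (rcons v d) != side g v ->
  reduce (g ++ V1) = reduce v /\ d = (E, true) \/
  reduce (rcons (g ++ V1) (E, true)) = reduce v /\ d = (E, false).
Proof.
rewrite /side !catA => /starts_with_step; rewrite -pinv_cat.
have K p : reduce (pinv (g ++ V1) ++ v) = reduce p -> reduce ((g ++ V1) ++ p) = reduce v.
  by move=> /(reduce_eqr (g ++ V1)) <-; rewrite -[LHS]/(reduce ([::] ++ _)) reduceVK.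
case=> -[e ->]; [left|right]; split=> //.
  by have := K [::] e; rewrite cats0.
by rewrite -cats1; exact: K.
Qed.

(* Along the path from [u] to [v], each step crosses at most one translate of
   [E], which is [h k j] for at most one [k]. *)
Lemma side_eventually (J : Type) (h : nat -> J -> pi1 x0) u v :
  (forall k k' j j', h k j = h k' j' -> k = k') ->
  exists N, forall k j, (N <= k)%N -> side (h k j) u = side (h k j) v.
Proof.
move=> h_inj.
suff H p : exists N, forall k j, (N <= k)%N -> side (h k j) p = side (h k j) [::].
  have [[N NP] [N' N'P]] := (H u, H v).
  by exists (N + N')%N => k j le; rewrite NP ?N'P //; lia.
elim/last_ind: p => [|p d [N NP]]; first by exists 0%N.
have [[k0 [j0 c0]]|none] :=
  pselect (exists k j, side (h k j) (rcons p d) != side (h k j) p); last first.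
  exists N => k j le; rewrite -NP //; apply: contrapT => /eqP ne.
  by apply: none; exists k, j.
(* The last step [d] crosses the translates of index [k0] only, so the bound is moved past [k0]. *)
exists (maxn N k0.+1) => k j; rewrite geq_max => /andP[le lt].
rewrite -NP //; apply: contrapT => /eqP/side_step c.
suff /h_inj e : h k j = h k0 j0 by rewrite e ltnn in lt.
case: (side_step c0) c => -[e0 ->] [] // -[e] // _.
  by apply: (@loop_inj_lift _ _ V1); rewrite e.
by apply: (@loop_inj_lift _ _ (rcons V1 (E, true))); rewrite -!rcons_cat e.
Qed.

Lemma expg_conj w u c k : reduce (w ++ u) = reduce (u ++ c) ->
  reduce ((w ^+ k)%g ++ u) = reduce (u ++ flatten (nseq k c)).
Proof.
move=> wu; elim: k => [|k IH]; first by rewrite cats0.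
rewrite expgS loop_mul_cat (reduce_eqr _ IH) [in LHS]catA (reduce_eql _ wu).
by rewrite -catA.
Qed.

Lemma starts_with_pinv z p :
  reduced (rcons p z) -> ~~ starts_with z (pinv p).
Proof.
case/lastP: p => [|p d] //; rewrite reduced_rcons pinv_rcons => /andP[_].
by rewrite /starts_with /= (inj_eq Some_inj) eq_sym.
Qed.

(* Writing [w = u c u^-1] with [c] cyclically reduced, the bi-infinite reduced
   path with period [c] is the axis of [w]; it crosses a lift of [E]. *)
Lemma belongs_axis w : belongs E w ->
  exists2 g, initial_word T w g &
    exists u, forall k i, (k < i)%N ->
      side (w ^+ k * g)%g u != side (w ^+ k * g)%g ((w ^+ i)%g ++ u).
Proof.
have [pw _ rw] := pi1P w.
have [u [c [wE cc]]] := cyclic_decomposition rw.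
move=> Ew; have /mapP[[E' b] /= cE EE'] : E \in map fst c.
  by apply: Ew; split=> //; rewrite wE; exact: contracts_conj.
have {cc} rc k := reduced_flatten k cc.
subst E'.
have wu : reduce (w ++ u) = reduce (u ++ c).
  by have := reduceK (u ++ c) u [::]; rewrite wE !cats0 -!catA.
case/splitPr: cE wE rc wu => c1 c2 wE rc wu.
(* If [b] is false, the axis runs along [E] backwards and meets the initial vertex of the lift only
   after that dart. *)
have [g gw gE] : exists2 g, initial_word T w g &
    reduce (g ++ V1) = reduce (u ++ c1 ++ (if b then [::] else [:: (E, b)])).
  move: pw; rewrite wE epath_cat epath_cat epath_cat => /and3P[_ /andP[_ /=]].
  rewrite -pend_cat => /andP[/eqP Eb _] _.
  set p := u ++ c1 ++ _.
  have [|g gw gE] := @initial_word_lift _ _ T w p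
    ((if b then [:: (E, b)] else [::]) ++ c2 ++ pinv u).
    by rewrite wE /p; case: (b); rewrite -!catA.
  exists g => //; rewrite -gE /V1; congr (reduce (_ ++ path_of (lift_vertex _ _ _))).
  by rewrite /p; case: (b) Eb; rewrite /dsrc /= => Eb; rewrite ?cats0 // catA pend_cat.
exists g => //; exists u => k i ki.
have {c} [c cE] : exists c, c = c1 ++ (E, b) :: c2 by exists (c1 ++ (E, b) :: c2).
rewrite -cE in rc wu.
have wg : reduce ((w ^+ k * g)%g ++ V1) =
    reduce (u ++ (flatten (nseq k c) ++ c1) ++ (if b then [::] else [:: (E, b)])).
  by rewrite loop_mul_cat (reduce_eqr _ gE) catA (reduce_eql _ (expg_conj k wu)) -!catA.
(* As [k < i], the first [i] periods contain the occurrence of [E] in the period numbered [k] from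
   zero; they are split there. *)
have ciE : flatten (nseq i c) =
    (flatten (nseq k c) ++ c1) ++ (E, b) :: c2 ++ flatten (nseq (i - k.+1) c).
  rewrite -{1}(subnKC ki) -addn1 -addnA add1n nseqD flatten_cat /= {2}cE.
  by rewrite -!catA.
rewrite (eq_side _ (expg_conj i wu)) !(sideE _ wg); have := rc i; rewrite ciE.
move: (_ ++ c1) (c2 ++ _) => p q {wg ciE} rpq.
have cancel s v : reduce (pinv (u ++ s) ++ u ++ v) = reduce (pinv s ++ v).
  by rewrite pinv_cat -catA reduceK.
have cancel0 s : reduce (pinv (u ++ s) ++ u) = reduce (pinv s).
  by rewrite -[in LHS](cats0 u) -catA cancel !cats0.
(* Seen from the initial vertex of the lift, exactly one of the two points is reached through [E]:
   the later one if [b] is true, the earlier one otherwise. Reducedness of the axis excludes further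
   cancellation. *)
rewrite cancel0 cancel; case: b rpq {Ew gw gE cE wE} => rpq.
  rewrite cats0 -[pinv p ++ _]/([::] ++ _) reduceK.
  move: rpq; rewrite -cat_rcons => rpq.
  have rp : reduced (rcons p (E, true)) by move: rpq; rewrite reduced_cat => /andP[].
  have rp' : reduced p by move: rp; rewrite -cats1 reduced_cat => /andP[].
  move: rpq; rewrite cat_rcons reduced_cat => /and3P[_ rq _].
  rewrite !reduce_id // ?reduced_pinv // (negbTE (starts_with_pinv rp)).
  by rewrite /starts_with /= eqxx.
rewrite cats1 -cat_rcons -[pinv _ ++ _]/([::] ++ _) reduceK.
have rq : reduced ((E, false) :: q) by move: rpq; rewrite reduced_cat => /and3P[].
move: rpq; rewrite -cat_rcons reduced_cat => /andP[rp _].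
have rq' : reduced q by exact: path_sorted rq.
rewrite !reduce_id // ?reduced_pinv // pinv_rcons.
rewrite [starts_with _ (_ :: _)]/starts_with /= eqxx.
by case: q rq {rq'} => [|d q] //; rewrite /reduced /= => /andP[].
Qed.

Lemma side_cat_notin g p q : E \notin map fst q -> side g (p ++ q) = side g p.
Proof.
elim/last_ind: q => [|q d IH]; first by rewrite cats0.
rewrite map_rcons mem_rcons inE negb_or => /andP[dE /IH <-].
rewrite -rcons_cat; apply: contraNeq dE.
by move=> /side_step[] [_ ->] /=.
Qed.

(** Let [v] conjugate [w] to a cyclic reduction [q] avoiding [E]; then [v ++ q] leads to the
    translate of [v] by [w], and its part [q] crosses no lift of [E]. *)
Lemma not_belongs_axis w : ~ belongs E w ->
  exists v, forall g, side g (w ++ v) = side g v.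
Proof.
move=> nE; have [q [wq _] qE] : exists2 q, cyclic_reduction w q & E \notin map fst q.
  apply: contrapT => none; apply: nE => q wq.
  by apply: contrapT => /negP qE; apply: none; exists q.
have [|v wv] := @contracts_conjugate _ (loop_of w) [::] _ _ wq; first by rewrite cats0.
by exists v => g; rewrite (eq_side _ wv) side_cat_notin.
Qed.

Section Stabilizer.
Variable v : seq (dart G).

(** These elements form a subgroup, which is used to tell positive powers of [w] from products of
    powers of [w']. *)
Definition side_fixes h := forall g, side g (h ++ v) = side g v.

Lemma side_fixesM h h' : side_fixes h -> side_fixes h' -> side_fixes (h * h')%g.
Proof.
move=> hv h'v g; rewrite (@eq_side _ _ (h ++ h' ++ v)) ?loop_mul_cat //.
by rewrite -[g](mulVKg h) side_mul h'v -(side_mul h) hv.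
Qed.

Lemma side_fixesV h : side_fixes h -> side_fixes h^-1%g.
Proof.
move=> hv g; rewrite -(side_mul h) (@eq_side _ _ v) -?hv ?side_mul //.
by rewrite -loop_mul_cat mulgV.
Qed.

Lemma side_fixesX h k : side_fixes h -> side_fixes (h ^+ k)%g.
Proof.
by move=> hv; elim: k => [|k IH] //; rewrite expgS; apply: side_fixesM.
Qed.

End Stabilizer.

Lemma expg_injective w :
  (forall k, (0 < k)%N -> w ^+ k <> 1)%g -> injective (fun k => w ^+ k)%g.
Proof.
move=> wt.
suff H k k' : (k <= k')%N -> (w ^+ k = w ^+ k')%g -> k = k'.
  by move=> k k' e; case: (leqP k k') => [/H->|/ltnW/H->].
move=> le; rewrite -(subnKC le) expgnDr -{1}[(w ^+ k)%g]mulg1 => /mulgI e.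
have : ~ (0 < k' - k)%N by move=> /wt; apply.
by lia.
Qed.

Lemma separating_translates w w' a b : belongs E w -> ~ belongs E w' ->
  exists2 g, initial_word T w g & exists N, forall k i j,
    (N <= k)%N -> (k + N <= i)%N ->
    side (w ^+ k * g)%g ((w ^+ i)%g ++ a) != side (w ^+ k * g)%g ((w' ^+ j)%g ++ b).
Proof.
move=> /belongs_axis[g gw [u axis]] /not_belongs_axis[v fixv]; exists g => //.
have w_inj : injective (fun k => w ^+ k)%g.
  apply: expg_injective => k k0 wk.
  by have := axis 0%N _ k0; rewrite wk eqxx.
(* Translating back by [w ^+ i] turns edges near the far end into negative translates, so
   [side_eventually] applies at both ends of the axis. *)
have side_shift k i x : (k <= i)%N ->
    side (w ^+ k * g)%g ((w ^+ i)%g ++ x) = side (w ^- (i - k) * g)%g x.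
  move=> ki; rewrite -[RHS](side_mul (w ^+ i)%g) mulgA; congr (side (_ * g)%g _).
  by rewrite -{1}(subnKC ki) expgnDr mulgK.
have pos x y : exists N, forall k, (N <= k)%N ->
    side (w ^+ k * g)%g x = side (w ^+ k * g)%g y.
  have [|N NP] := @side_eventually unit (fun k _ => w ^+ k * g)%g x y.
    by move=> k k' _ _ /mulIg/w_inj.
  by exists N => k; exact: (NP k tt).
have neg x y : exists N, forall k i, (k + N <= i)%N ->
    side (w ^+ k * g)%g ((w ^+ i)%g ++ x) = side (w ^+ k * g)%g ((w ^+ i)%g ++ y).
  have [|N NP] := @side_eventually unit (fun k _ => w ^- k * g)%g x y.
    by move=> k k' _ _ /mulIg/invg_inj/w_inj.
  by exists N => k i ki; rewrite !side_shift ?(NP _ tt) //; lia.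
have [N1 N1P] := pos u v; have [N2 N2P] := neg a u; have [N3 N3P] := neg v u.
(* Otherwise all powers of [w ^+ k] fix the sides of [v]; but the lift of index [N1] separates [u]
   from a far translate of [u], and there [u] may be replaced by [v] at both ends. *)
have nofix k : (0 < k)%N -> ~ side_fixes v (w ^+ k)%g.
  move=> k0 /side_fixesX wk.
  have := axis N1 (k * (N1 + N3).+1)%N; rewrite N1P // -N3P; last nia.
  by rewrite expgnA wk eqxx => /(_ _)/negP[] //; nia.
(* The bound is uniform in [j]: two such translates with different [k] coincide only if a positive
   power of [w] lies in the subgroup generated by [w'], against [nofix]. *)
have [|N4 N4P] := @side_eventually nat (fun k j => w' ^- j * (w ^+ k * g))%g b v.
  suff H k k' j j' : (k < k')%N ->
      (w' ^- j * (w ^+ k * g) <> w' ^- j' * (w ^+ k' * g))%g.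
    move=> k k' j j' e; case: (ltngtP k k') => // lt.
      by case: (H _ _ j j' lt).
    by case: (H _ _ j' j lt).
  move=> lt; rewrite !mulgA => /mulIg e.
  have {e} e : (w ^+ (k' - k) = w' ^+ j' * w' ^- j)%g.
    by rewrite expgnFr 1?ltnW // -(mulVKg (w' ^+ j')%g (w ^+ k')%g) -e !mulgA mulgK.
  apply: (@nofix (k' - k)%N); first by rewrite subn_gt0.
  by rewrite e; apply: side_fixesM; [|apply: side_fixesV]; exact: side_fixesX.
exists (maxn (maxn N1 N2) N4).+1 => k i j kN ki.
(* Pull back by [w' ^+ j], replace [b] by [v], push forward again, and use that [w' ^+ j] fixes the
   sides of [v]. *)
have -> : side (w ^+ k * g)%g ((w' ^+ j)%g ++ b) = side (w ^+ k * g)%g v.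
  rewrite -(side_mul (w' ^- j)%g) (@eq_side _ _ b); last first.
    by rewrite -loop_mul_cat mulVg.
  rewrite N4P; last lia.
  by rewrite -(side_mul (w' ^+ j)%g) mulVKg side_fixesX.
rewrite -N1P ?N2P; [|lia..]; rewrite eq_sym; apply: axis; lia.
Qed.

End Sides.

(** * Continuous functions on realizations of graphs *)

Section RealizationMaps.
Variables (R : realType) (G H : digraph).

Lemma edge_map0 (e : edge G) : edge_map e (0 : R) = RVertex (src e).
Proof. by rewrite /edge_map insubN ?ltxx // lexx. Qed.

Lemma edge_map1 (e : edge G) : edge_map e (1 : R) = RVertex (tgt e).
Proof. by rewrite /edge_map insubN ?ltxx ?andbF // ler10. Qed.

Lemma edge_map_val (e : edge G) (t : {t : R | 0 < t < 1}) :
  edge_map e (val t) = REdge e t.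
Proof. by rewrite /edge_map valK. Qed.

Lemma edge_map_continuous (e : edge G) : continuous (edge_map e : R -> realization R G).
Proof. by apply/continuousP => A oA; exact: oA. Qed.

Lemma realization_map_edge (phiV : vertex G -> vertex H) (phiE : edge G -> edge H)
    (e : edge G) (t : R) :
  phiV (src e) = src (phiE e) -> phiV (tgt e) = tgt (phiE e) ->
  realization_map phiV phiE (edge_map e t) = edge_map (phiE e) t.
Proof.
move=> es et; rewrite /edge_map; case: insub => //=.
by case: ifP => _ /=; rewrite ?es ?et.
Qed.

Definition affine_ext (h : vertex G -> R) (x : realization R G) : R :=
  match x with
  | RVertex v => h v
  | REdge e t => (1 - val t) * h (src e) + val t * h (tgt e)
  end.

Lemma affine_ext_continuous h : continuous (affine_ext h : realization R G -> R).
Proof.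
apply/continuousP => A oA; rewrite -[open _]/(realization_open _) => e.
rewrite -comp_preimage.
(* Since [edge_map] retracts the line onto the unit interval, the composite is affine in the clamped
   parameter. *)
have -> : affine_ext h \o edge_map e = fun t : R =>
    (1 - Num.max 0 (Num.min t 1)) * h (src e) + Num.max 0 (Num.min t 1) * h (tgt e).
  apply/funext => t /=; rewrite /edge_map; case: insubP => [s /andP[t0 t1] se|].
    by rewrite (min_idPl (ltW t1)) (max_idPr (ltW t0)) -se.
  rewrite negb_and -!leNgt; case: ifP => [t0 _|/negbT].
    by rewrite (min_idPl (le_trans t0 ler01)) (max_idPl t0) /=; ring.
  rewrite -ltNge => t0 /= t1.
  by rewrite (min_idPr t1) (max_idPr ler01); ring.
have clamp : continuous (fun t : R => Num.max 0 (Num.min t 1)).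
  move=> t; apply: (@continuous_max R _ (fun=> 0) (fun t : R => Num.min t 1)).
    exact: cst_continuous.
  apply: (@continuous_min R _ id (fun=> 1)); [exact: id|exact: cst_continuous].
apply: open_comp => // t _.
apply: cvgD; apply: cvgM; try exact: cvg_cst; last exact: clamp.
by apply: cvgB; [exact: cvg_cst|exact: clamp].
Qed.

End RealizationMaps.

(** * Iterates of the lifted map and the intermediate value argument *)

Section Lifts.
Variables (R : realType) (G : digraph) (x0 : vertex G) (T : spanning_tree G).
Implicit Types (g h w : pi1 x0) (u v : vertex (ucover x0)) (a : edge (ucover x0)).

Lemma deckV_mul g h u : deckV (g * h)%g u = deckV g (deckV h u).
Proof. by apply: val_inj; rewrite /= reduce_catl reduce_catr catA. Qed.

Lemma deckV_tgt g a : deckV g (tgt a) = tgt (deckE g a).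
Proof.
by apply: val_inj; rewrite /= reduce_catr -!cats1 reduce_catl catA.
Qed.

Lemma deck_edge_map g a (t : R) : deck g (edge_map a t) = edge_map (deckE g a) t.
Proof. by apply: realization_map_edge => //; exact: deckV_tgt. Qed.

Lemma lift_vertex_tgt (e : edge G) : in_tree T e ->
  lift_vertex x0 T (tgt e) = tgt (lift_edge x0 T e).
Proof. by move=> Te; apply: val_inj; exact: (lift_vertex_tree x0 (d := (e, true))). Qed.

Lemma lift_point_edge_map (e : edge G) (t : R) : in_tree T e ->
  lift_point x0 T (edge_map e t) = edge_map (lift_edge x0 T e) t.
Proof.
by move=> Te; apply: realization_map_edge => //; exact: lift_vertex_tgt.
Qed.

Lemma covering_deck g (y : realization R (ucover x0)) :
  covering_map (deck g y) = covering_map y.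
Proof. by case: y => //= v; rewrite /covering_map /= rend_deckV. Qed.

Lemma covering_lift (x : realization R G) : covering_map (lift_point x0 T x) = x.
Proof. by case: x => //= v; rewrite /covering_map /= rend_lift. Qed.

Variable E : edge G.
Hypothesis G_loopless : loopless G.

Section Height.
Variable g : pi1 x0.

Let gE : edge (ucover x0) := deckE g (lift_edge x0 T E).

Lemma side_edge a :
  a != gE -> side T E g (tgt a : rpath x0) = side T E g (src a : rpath x0).
Proof.
apply: contraNeq.
rewrite (@eq_side _ _ T E g _ (rcons (path_of (src a)) ((ledge_of a).2, true)));
  last first.
  by rewrite /= reduce_id ?reduce_reduced.
move=> /side_step[] [e []] // aE; apply/eqP/val_inj.
rewrite [LHS]surjective_pairing aE; congr pair; apply: val_inj.
by rewrite /= e reduce_id //; have [] := rpathP (ledge_of a).1.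
Qed.

Lemma side_gE :
  side T E g (src gE : rpath x0) = false /\ side T E g (tgt gE : rpath x0).
Proof.
have e : reduce (g ++ lift_vertex x0 T (src E)) = reduce (path_of (src gE)).
  by rewrite [RHS]reduce_id ?reduce_reduced.
rewrite !(sideE _ e) reduce_pinvl; split=> //.
rewrite [X in _ ++ X]/= reduce_catr -cats1.
by rewrite -[pinv _ ++ _]/([::] ++ _) reduceK /starts_with /= eqxx.
Qed.

(* The edge [gE] is stretched to [[0, 1]], and the vertices other than its ends
   are moved away from [[0, 1]], so that [affine_ext height] takes a value in
   [[0, 1]] only on the closed edge [gE]. *)
Definition height v : R :=
  if v == src gE then 0 else if v == tgt gE then 1
  else if side T E g (v : rpath x0) then 2 else -1.

Lemma height_sideF v : side T E g (v : rpath x0) = false ->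
  height v = -1 \/ height v = 0 /\ v = src gE.
Proof.
rewrite /height => sv; case: eqP => [|_]; first by right.
by rewrite sv; case: eqP => [vt|_]; [move: sv; rewrite vt side_gE.2|left].
Qed.

Lemma height_sideT v : side T E g (v : rpath x0) ->
  height v = 2 \/ height v = 1 /\ v = tgt gE.
Proof.
rewrite /height => sv; case: eqP => [vs|_].
  by move: sv; rewrite vs side_gE.1.
by rewrite sv; case: eqP => [|_]; [right|left].
Qed.

Lemma ucover_loopless a : src a <> tgt a.
Proof.
move=> /(congr1 (@rend G x0)) /=; rewrite [rend (ledge_tgt a)]/rend /=.
rewrite (epath_reduce (ledge_tgt_subproof a)).2 -cats1 pend_cat.
by rewrite [rend _]ledgeP; apply/eqP/G_loopless.
Qed.

(** Any other edge has both ends on one side, with heights in {-1, 0} or in {1, 2}. An interior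
    point gets a value in [0, 1] only if both ends are the same end of [gE], which would make the
    edge a loop. *)
Lemma affine_height_inv (t : R) x : 0 <= t <= 1 ->
  affine_ext height x = t -> x = edge_map gE t.
Proof.
move=> /andP[t0 t1]; case: x => [v|a s] /=.
  case sv: (side T E g (v : rpath x0)).
    case: (height_sideT sv) => [->|[-> ->]] te; first by exfalso; lra.
    by rewrite -te edge_map1.
  case: (height_sideF sv) => [->|[-> ->]] te; first by exfalso; lra.
  by rewrite -te edge_map0.
rewrite -edge_map_val /=; have /= := valP s; move: (sval s) => {}s /andP[s0 s1].
have [->|ne] := eqVneq a gE.
  have [sF sT] := side_gE.
  have -> : height (src gE) = 0 by rewrite /height eqxx.
  have -> : height (tgt gE) = 1.
    rewrite /height eqxx; case: eqP => // e; case: (@ucover_loopless gE); exact/esym.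
  by rewrite mulr0 add0r mulr1 => ->.
have st := side_edge ne; have nl := @ucover_loopless a.
case sv: (side T E g (src a : rpath x0)) st => st.
  case: (height_sideT sv) (height_sideT st) => [->|[-> e1]] [->|[-> e2]] te.
  - by exfalso; lra.
  - by exfalso; lra.
  - by exfalso; lra.
  - by case: nl; rewrite e1 e2.
case: (height_sideF sv) (height_sideF st) => [->|[-> e1]] [->|[-> e2]] te.
- by exfalso; lra.
- by exfalso; lra.
- by exfalso; lra.
- by case: nl; rewrite e1 e2.
Qed.

Lemma height_ends u v : side T E g (u : rpath x0) != side T E g (v : rpath x0) ->
  Num.min (height u) (height v - 1) <= 0 <= Num.max (height u) (height v - 1).
Proof.
rewrite ge_min le_max.
case su: (side T E g (u : rpath x0)); case sv: (side T E g (v : rpath x0)) => // _.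
  by case: (height_sideT su) (height_sideF sv) => [->|[-> _]] [->|[-> _]]; lra.
by case: (height_sideF su) (height_sideT sv) => [->|[-> _]] [->|[-> _]]; lra.
Qed.

End Height.

Variables (f : realization R G -> realization R G)
  (ft : realization R (ucover x0) -> realization R (ucover x0)).
Hypothesis ft_lift : is_lift f ft.
Hypothesis ft_deck : forall g y, ft (deck g y) = deck g (ft y).

Lemma fixed_with_lift n w x :
  iter n ft (lift_point x0 T x) = deck w (lift_point x0 T x) ->
  fixed_with T f ft n w x.
Proof.
move=> e; split=> //; have [_ ftf] := ft_lift.
have cov k y : covering_map (iter k ft y) = iter k f (covering_map y).
  by elim: k => //= k <-; exact: ftf.
by rewrite -{1}[x]covering_lift -cov e covering_deck covering_lift.
Qed.

Lemma iter_fixed_vertex n w u k :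
  iter n ft (RVertex u) = deck w (RVertex u) ->
  iter (k * n) ft (RVertex u) = RVertex (deckV (w ^+ k)%g u).
Proof.
have iter_deck i g y : iter i ft (deck g y) = deck g (iter i ft y).
  by elim: i => //= i ->; exact: ft_deck.
move=> nu; elim: k => [|k IH].
  by congr RVertex; apply: val_inj; rewrite /= reduce_id //; have [] := rpathP u.
rewrite mulSn iterD IH -[RVertex _]/(deck _ (RVertex u)) iter_deck nu.
by rewrite expgSr deckV_mul.
Qed.

Lemma crossing_fixed_point g n u v : in_tree T E ->
  iter n ft (RVertex (lift_vertex x0 T (src E))) = RVertex u ->
  iter n ft (RVertex (lift_vertex x0 T (tgt E))) = RVertex v ->
  side T E g (u : rpath x0) != side T E g (v : rpath x0) ->
  exists2 x, closed_edge E x & fixed_with T f ft n g x.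
Proof.
move=> E_tree nu nv suv; set e := lift_edge x0 T E.
(* At a zero [t], the image has height [t], hence is the point of parameter [t] on the translate of
   [e] by [g]. *)
pose phi (t : R) := affine_ext (height g) (iter n ft (edge_map e t)) - t.
have phi_cont : continuous phi.
  have [ft_cont _] := ft_lift.
  have iter_cont k : continuous (iter k ft).
    elim: k => [|k IH] y; first exact: cvg_id.
    exact: (continuous_comp (IH y) (ft_cont _)).
  move=> t; have c := continuous_comp (@edge_map_continuous R _ e t) (iter_cont n _).
  have c' := continuous_comp c (@affine_ext_continuous R _ (height g) _).
  exact: (cvgB c' cvg_id).
have phi0 : phi 0 = height g u.
  by rewrite /phi edge_map0 subr0 [src e]/= nu.
have phi1 : phi 1 = height g v - 1.
  by rewrite /phi edge_map1 -lift_vertex_tgt // nv.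
have [|t] := @IVT R phi 0 1 0 ler01 (continuous_subspaceT phi_cont).
  by rewrite phi0 phi1; exact: height_ends.
rewrite in_itv /= => t01 /eqP; rewrite subr_eq0 => /eqP /(affine_height_inv t01) te.
exists (edge_map E t); first by exists t => //=; rewrite in_itv.
by apply: fixed_with_lift; rewrite lift_point_edge_map // te deck_edge_map.
Qed.

End Lifts.

(** * Choice of the exponents, and conclusion *)

Lemma rat_exponents (r : rat) (m n N : nat) :
  (0 < m)%N -> (0 < n)%N -> 0 < r < m%:R^-1 ->
  exists p i j : nat, [/\ (0 < i * m)%N, (i * m = j * n)%N,
    r = p%:R / (i * m)%:R, (N <= p)%N & (p + N <= i)%N].
Proof.
move=> m0 n0 /andP[r0 rm]; set a := `|numq r|%N; set b := `|denq r|%N.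
have aE : a%:R = (numq r)%:~R :> rat.
  by rewrite -(@gez0_abs (numq r)) ?numq_ge0 ?ltW.
have bE : b%:R = (denq r)%:~R :> rat by rewrite -absz_denq.
have rE : r = a%:R / b%:R by rewrite aE bE divq_num_den.
have b0 : (0 < b)%N by rewrite absz_gt0 denq_neq0.
have a0 : (0 < a)%N by rewrite absz_gt0 numq_eq0 gt_eqF.
have ab : (a * m < b)%N.
  move: rm; rewrite {1}rE ltr_pdivrMr ?ltr0n // mulrC ltr_pdivlMr ?ltr0n //.
  by rewrite -natrM ltr_nat.
have K0 : (N < n * N.+1)%N by rewrite leq_pmull.
(* The fraction [a / b] is expanded by [m * n * N.+1]: the factor [m * n] makes the denominator a
   common multiple, and [N.+1] makes [p] large, as well as [i - p] because [a * m < b]. *)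
exists (a * m * (n * N.+1))%N, (b * (n * N.+1))%N, (b * m * N.+1)%N; split.
- by rewrite !muln_gt0 b0 n0 m0.
- by ring.
- rewrite rE; have := m0; have := n0; rewrite -2!(ltr0n rat) => n0' m0'.
  have b0' : 0 < b%:R :> rat by rewrite ltr0n.
  have N0' : 0 < N.+1%:R :> rat by rewrite ltr0n.
  by rewrite !natrM; field; rewrite ?gt_eqF.
- by rewrite (leq_trans (ltnW K0)) // leq_pmull // muln_gt0 a0.
- rewrite (leq_trans (n := (a * m).+1 * (n * N.+1))) ?leq_mul2r ?ab ?orbT //.
  by rewrite mulSn addnC leq_add2r ltnW.
Qed.

Lemma side_deckV (G : digraph) (x0 : vertex G) (T : spanning_tree G) E (g h : pi1 x0)
    (u : vertex (ucover x0)) :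
  side T E g (deckV h u : rpath x0) = side T E g (h ++ (u : rpath x0)).
Proof. by apply: eq_side; rewrite reduce_id ?reduce_reduced. Qed.

Theorem theorem24 (R : realType) (G : digraph) (x0 : vertex G)
    (G_finite : finite_graph G) (G_loopless : loopless G)
    (G_connected : connected_graph G) (T : spanning_tree G)
    (f : realization R G -> realization R G)
    (f_cont : continuous f) (f_vertex : vertex_map f)
    (f_homotopic : homotopic R f id)
    (ft : realization R (ucover x0) -> realization R (ucover x0))
    (ft_lift : is_lift f ft)
    (ft_deck : forall (g : pi1 x0) y, ft (deck g y) = deck g (ft y))
    (E : edge G) (E_tree : in_tree T E)
    (m n : nat) (w1 w2 : pi1 x0) (m_gt0 : (0 < m)%N) (n_gt0 : (0 < n)%N)
    (V1_rot : fixed_with T f ft m w1 (RVertex (src E)))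
    (V2_rot : fixed_with T f ft n w2 (RVertex (tgt E))) :
  (belongs E w1 -> ~ belongs E w2 ->
     exists2 g1 : pi1 x0, initial_word T w1 g1 &
       forall r : rat, 0 < r < m%:R^-1 ->
         exists p q : nat, [/\ (0 < q)%N, r = p%:R / q%:R &
           exists2 x, closed_edge E x &
             has_rotation_element T f ft x (w1 ^+ p * g1)%g q])
  /\
  (belongs E w2 -> ~ belongs E w1 ->
     exists2 g2 : pi1 x0, initial_word T w2 g2 &
       forall s : rat, 0 < s < n%:R^-1 ->
         exists p q : nat, [/\ (0 < q)%N, s = p%:R / q%:R &
           exists2 x, closed_edge E x &
             has_rotation_element T f ft x (w2 ^+ p * g2)%g q]).
Proof.
have [_ V1w] := V1_rot; have [_ V2w] := V2_rot.
(* The two ends of [E] enter symmetrically, so this claim serves both parts. *)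
have periodic i j g : (i * m = j * n)%N -> (0 < i * m)%N ->
    side T E g ((w1 ^+ i)%g ++ lift_vertex x0 T (src E)) !=
      side T E g ((w2 ^+ j)%g ++ lift_vertex x0 T (tgt E)) ->
    exists2 x, closed_edge E x & has_rotation_element T f ft x g (i * m).
  move=> ij im0 sep.
  have [||x Ex fx] := crossing_fixed_point G_loopless ft_lift E_tree
    (iter_fixed_vertex ft_deck i V1w)
    (v := deckV (w2 ^+ j)%g (lift_vertex x0 T (tgt E)))
    (g := g) _ _.
  - by rewrite ij; exact: iter_fixed_vertex.
  - by rewrite !side_deckV.
  by exists x => //; exists (i * m)%N, g.
split=> wE wE'.
  have [g gw [N sep]] := separating_translates T (lift_vertex x0 T (src E) : rpath x0)
    (lift_vertex x0 T (tgt E) : rpath x0) wE wE'.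
  exists g => // r /(rat_exponents N m_gt0 n_gt0)[p [i [j [im ij rE pN pi]]]].
  exists p, (i * m)%N; split=> //; apply: (@periodic _ j) => //.
  exact: sep.
(* The ends exchange roles, so now [p] is compared with [j], the exponent of [w2]. *)
have [g gw [N sep]] := separating_translates T (lift_vertex x0 T (tgt E) : rpath x0)
  (lift_vertex x0 T (src E) : rpath x0) wE wE'.
exists g => // r /(rat_exponents N n_gt0 m_gt0)[p [j [i [jn ji rE pN pj]]]].
exists p, (j * n)%N; split=> //; rewrite ji; apply: (@periodic _ j); rewrite -?ji //.
by rewrite eq_sym; apply: sep.
Qed.
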